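(* Let $f=\frac1n\sum_{i=1}^n f_i$ satisfy: (1) each $\nabla f_i$ is $L$-Lipschitz on $\mathbb{R}^d$; (2) $f^*=\inf_{x} f(x)>-\infty$; (3) there is $\sigma>0$ with $\frac1n\sum_{i=1}^n\|\nabla f_i(x)-\nabla f(x)\|^2\le\sigma^2$ for all $x\in\mathbb{R}^d$. Let $\epsilon>0$, choose the constant stepsize $\eta=\frac1{4L}$, the epoch length $m=\sqrt{B}$ (where $B$ denotes the mini-batch size), $c_\beta,c_\epsilon\ge16$, and $0<\beta_1\le\epsilon S$, where $S$ is the number of epochs and $K=Sm$ is the total number of iterations. Then, to achieve $\mathbb{E}\|\nabla f(x_\zeta)\|^2\le\epsilon$ for the output $x_\zeta$ of AbaSVRG, the total SFO complexity of AbaSVRG is given by $$\underbrace{\sum_{s=1}^S\min\Big\{\frac{c_\beta\sigma^2}{\sum_{t=1}^m\|v_{t-1}^{s-1}\|^2/m},\,c_\epsilon\sigma^2\epsilon^{-1},\,n\Big\}+KB}_{\text{complexity of AbaSVRG}}\ <\ \underbrace{S\min\{c_\epsilon\sigma^2\epsilon^{-1},n\}+KB}_{\text{complexity of vanilla SVRG}}=\mathcal{O}\Big(\frac{n\wedge\epsilon^{-1}}{\sqrt{B}\,\epsilon}+\frac{B}{\epsilon}\Big),$$ where for $s=1$ the quantity $\sum_{t=1}^m\|v_{t-1}^{s-1}\|^2/m$ stands for the input $\beta_1$. If we choose $B=n^{2/3}\wedge\epsilon^{-2/3}$, then the worst-case complexity is $\mathcal{O}\big(\epsilon^{-1}(n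\wedge\epsilon^{-1})^{2/3}\big)$.
   Context: $a\wedge b=\min\{a,b\}$. For a finite index set (or list) $\mathcal{S}$, $\nabla f_{\mathcal{S}}(\cdot)=\frac1{|\mathcal{S}|}\sum_{i\in\mathcal{S}}\nabla f_i(\cdot)$. AbaSVRG. Inputs: $x_0\in\mathbb{R}^d$, epoch length $m$, mini-batch size $B$, number of epochs $S$, and reals $\eta,c_\beta,c_\epsilon,\beta_1>0$; $\epsilon>0$ is the target accuracy. Set $\tilde x^0=x_0$. For $s=1,\dots,S$: set $x_0^s=\tilde x^{s-1}$; sample $\mathcal{N}_s$ from $[n]=\{1,\dots,n\}$ uniformly without replacement, of size $N_s=\min\{c_\beta\sigma^2\beta_s^{-1},\,c_\epsilon\sigma^2\epsilon^{-1},\,n\}$; set $g^s=\nabla f_{\mathcal{N}_s}(\tilde x^{s-1})$; for $t=1,\dots,m$, draw a fresh mini-batch $\mathcal{B}$ of size $B$ uniformly from $[n]$ with replacement and set $v_{t-1}^s=\nabla f_{\mathcal{B}}(x_{t-1}^s)-\nabla f_{\mathcal{B}}(\tilde x^{s-1})+g^s$, $x_t^s=x_{t-1}^s-\eta v_{t-1}^s$; finally set $\beta_{s+1}=\frac1m\sum_{t=1}^m\|v_{t-1}^s\|^2$ and $\tilde x^s=x_m^s$. The output $x_\zeta$ is chosen uniformly at random from $\{x_{t-1}^s\}_{s\in[S],\,t\in[m]}$. Sizes that are not integers are understood to be rounded. SFO complexity: the stochastic first-order oracle (SFO), given $x$, takes a random index $i\in[n]$ and returns $\nabla f_i(x)$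 with $\mathbb{E}_i[\nabla f_i(x)]=\nabla f(x)$; the SFO complexity is the number of oracle calls, counted as in the displayed expressions. Vanilla SVRG is the same method with the fixed outer batch size $\min\{c_\epsilon\sigma^2\epsilon^{-1},n\}$. $\mathcal{O}(\cdot)$ hides constants that do not depend on $n$, $B$, $\epsilon$.
   Formalization: The strict ''<'' (false for constant f_i) is proved as ''≤'' with an exact criterion for strictness; since S ≥ 1 is an integer, the O-bounds are proved for ε√B ≤ κ, and for ε ≤ κ in the last claim, for any fixed κ > 0 on which the constant may depend. *)

(* Defs.v *)
From HB Require Import structures.
From mathcomp Require Import all_boot all_order all_algebra.
From mathcomp Require Import all_classical all_reals all_analysis.
Import Order.TTheory GRing.Theory Num.Theory.
Import numFieldNormedType.Exports.

Set Implicit Arguments.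
Unset Strict Implicit.
Unset Printing Implicit Defensive.

Local Open Scope classical_set_scope.
Local Open Scope ring_scope.

(* The library norm on 'rV[R]_d is the sup norm, hence this Euclidean one. *)
Definition enorm (R : realType) (d : nat) (v : 'rV[R]_d) : R :=
  Num.sqrt (\sum_(j < d) v ord0 j ^+ 2).

Definition grad (R : realType) (d : nat) (f : 'rV[R]_d -> R) (x : 'rV[R]_d)
  : 'rV[R]_d :=
  \row_(j < d) 'D_(delta_mx ord0 j) (f : 'rV[R]_d -> R^o) x.

Definition mean_fun (R : realType) (d n : nat) (fs : 'I_n -> 'rV[R]_d -> R)
  (x : 'rV[R]_d) : R := n%:R^-1 * \sum_(i < n) fs i x.

(* Repetitions in s count with multiplicity. *)
Definition avg_grad (R : realType) (d n : nat) (fs : 'I_n -> 'rV[R]_d -> R)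
  (s : seq 'I_n) (x : 'rV[R]_d) : 'rV[R]_d :=
  (size s)%:R^-1 *: \sum_(i <- s) grad (fs i) x.

(* Rounding of positive reals to one of the two neighbouring integers, never
   to 0; an integer is left unchanged. *)
Definition is_rounding (R : realType) (rnd : R -> nat) : Prop :=
  forall x : R, 0 < x -> (0 < rnd x)%N /\ `|(rnd x)%:R - x| < 1.

Definition svrg_size (R : realType) (ceps sigma eps : R) (n : nat) : R :=
  Num.min (ceps * sigma ^+ 2 * eps^-1) n%:R.

(* Unrounded outer batch size as a function of beta.  When beta = 0 the term
   cbeta * sigma ^ 2 / beta is +oo and drops out of the minimum (in the library
   it would evaluate to 0). *)
Definition aba_size (R : realType) (cbeta ceps sigma eps : R) (n : nat)
  (beta : R) : R :=
  if beta == 0 then svrg_size ceps sigma eps n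
  else Num.min (cbeta * sigma ^+ 2 / beta) (svrg_size ceps sigma eps n).

(* The random choices of one epoch: the index set sampled without replacement
   and the m mini-batches, each a list of B indices. *)
Definition epoch_sample (n m B : nat) : finType :=
  ({set 'I_n} * m.-tuple (B.-tuple 'I_n))%type.

(* The random choices of a whole run; the last component is the pair of indices
   (epoch, inner iteration), both counted from 0, of the output. *)
Definition run (n m B S : nat) : finType :=
  (S.-tuple (epoch_sample n m B) * ('I_S * 'I_m))%type.

Section AbaSVRG.
Context (R : realType) (d n m B : nat) (fs : 'I_n -> 'rV[R]_d -> R) (eta : R).
Implicit Types (x xt g : 'rV[R]_d) (e : epoch_sample n m B).

(* xt is the snapshot of the epoch and g the outer gradient estimate. *)
Definition vr_grad xt g (b : seq 'I_n) x : 'rV[R]_d :=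
  avg_grad fs b x - avg_grad fs b xt + g.

Definition outer_grad xt e : 'rV[R]_d := avg_grad fs (enum e.1) xt.

(* x_t of the epoch, 0 <= t <= m *)
Definition inner_iter xt e (t : nat) : 'rV[R]_d :=
  foldl (fun x (b : B.-tuple 'I_n) =>
           x - eta *: vr_grad xt (outer_grad xt e) b x)
        xt (take t e.2).

(* v_t of the epoch, 0 <= t < m *)
Definition inner_dir xt e (t : 'I_m) : 'rV[R]_d :=
  vr_grad xt (outer_grad xt e) (tnth e.2 t) (inner_iter xt e t).

(* The state between two epochs is the pair (snapshot, beta). *)
Definition epoch_step (st : 'rV[R]_d * R) e : 'rV[R]_d * R :=
  (inner_iter st.1 e m,
   m%:R^-1 * \sum_(t < m) enorm (inner_dir st.1 e t) ^+ 2).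

Context (N : R -> nat) (x0 : 'rV[R]_d) (beta1 : R) (S : nat).
Implicit Types (w : run n m B S).

(* Epochs are counted from 0: state w s is the state at the start of the epoch
   number s + 1. *)
Definition state w (s : nat) : 'rV[R]_d * R :=
  foldl epoch_step (x0, beta1) (take s w.1).

Definition beta w (s : nat) : R := (state w s).2.

Definition output w : 'rV[R]_d :=
  inner_iter (state w w.2.1).1 (tnth w.1 w.2.1) w.2.2.

(* Probability of the run w, by the chain rule: conditionally on the past, the
   outer index set is uniform among the sets of N (beta w s) indices, every
   mini-batch is uniform among the n ^ B lists, and the output indices are
   uniform and independent of everything else. *)
Definition run_prob w : R :=
  (\prod_(s < S)
     ((#|(tnth w.1 s).1| == N (beta w s))%:R / 'C(n, N (beta w s))%:R
      * \prod_(t < m) (n%:R ^+ B)^-1))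
  * (S%:R * m%:R)^-1.

Definition run_expect (X : run n m B S -> R) : R :=
  \sum_(w : run n m B S) run_prob w * X w.

End AbaSVRG.

Definition aba_sfo (R : realType) (d n m B : nat) (fs : 'I_n -> 'rV[R]_d -> R)
  (eta cbeta ceps sigma eps : R) (x0 : 'rV[R]_d) (beta1 : R) (S : nat)
  (w : run n m B S) : R :=
  \sum_(s < S) aba_size cbeta ceps sigma eps n (beta fs eta x0 beta1 w s)
  + (S * m * B)%:R.

Definition svrg_sfo (R : realType) (ceps sigma eps : R) (n m B S : nat) : R :=
  S%:R * svrg_size ceps sigma eps n + (S * m * B)%:R.

(* Main.v *)
Require Import Defs.
From HB Require Import structures.
From mathcomp Require Import all_boot all_order all_algebra.
From mathcomp Require Import all_classical all_reals all_analysis.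
From mathcomp Require Import fingroup perm ring lra zify.
Import Order.TTheory GRing.Theory Num.Theory.
Import numFieldNormedType.Exports.

Set Implicit Arguments.
Unset Strict Implicit.
Unset Printing Implicit Defensive.

Local Open Scope classical_set_scope.
Local Open Scope ring_scope.

(** The rate of convergence is a potential argument on two nested time scales.

    Write q_s for the squared error of the outer estimate of epoch s, and xt for
    its snapshot.  Inside an epoch, smoothness with eta = 1 / (4 L) gives, along every path,
    |grad f (x)|^2 + (2 / eta) f (x - eta v)
      <= (2 / eta) f (x) - (3 / 4) |v|^2 + |v - grad f (x)|^2.
    The expectation of |v - grad f (x)|^2 is at most
    q_s + (L^2 / B) |x - xt|^2 ([vr_grad_variance]), and after t steps
    |x - xt|^2 <= eta^2 t Q, where Q is the sum of the squared directions so
    far ([step_sqr_le]).  As m^2 <= 2 B, the term - (3 / 4) |v|^2 absorbs all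
    this drift and still leaves a multiple of Q at the end of the epoch.  At the
    end of the epoch Q = m beta, with beta the quantity that governs the next
    outer batch: this leftover is what pays for an adaptive batch.

    Sampling without replacement makes the expectation of q_s at most
    (beta_s + eps) / 8, since the batch is the whole sample or has at least half
    of its unrounded size ([aba_batch_variance]).  So
    (2 / eta) (f - inf f) + (m / 8) beta decreases in mean, over an epoch, by
    the sum of the |grad f|^2 up to m eps / 8 ([epoch_bound]), and summing over
    the epochs ([aba_expect_bound]) bounds the mean square gradient of the
    output by 8 L (f x0 - inf f) / (S m) + beta_1 / (8 S) + eps / 8.  Each of the
    last two terms is at most eps / 8, and the first one is at most 3 eps / 4
    once S m eps >= 11 L Delta.

    The comparison of complexities is the pointwise inequality of the batch
    sizes, and the orders of magnitude follow from S being at most of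
    order 1 / (sqrt B eps) ([svrg_sfo_le], [optimal_batch]).

    Both time scales use the same principle, [potential_bound], for a state
    driven by a tuple of random choices. *)

(** * Euclidean norm and smoothness *)

Section Euclidean.
Context (R : realType) (d : nat).
Implicit Types (u v x y : 'rV[R]_d).

Definition dot u v : R := \sum_(j < d) u ord0 j * v ord0 j.

Lemma enorm_sqr v : enorm v ^+ 2 = \sum_(j < d) v ord0 j ^+ 2.
Proof. by rewrite sqr_sqrtr // sumr_ge0 // => j _; exact: sqr_ge0. Qed.

Lemma enorm_ge0 v : 0 <= enorm v.
Proof. exact: sqrtr_ge0. Qed.

(** Lagrange's identity: twice the defect in the Cauchy-Schwarz inequality is
    the sum, over ordered pairs of columns, of the squared 2 x 2 minors of the
    matrix with rows u and v. *)
Lemma dot_sqr_le u v : dot u v ^+ 2 <= enorm u ^+ 2 * enorm v ^+ 2.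
Proof.
suff: 0 <= 2 * (enorm u ^+ 2 * enorm v ^+ 2 - dot u v ^+ 2) by lra.
have -> : 2 * (enorm u ^+ 2 * enorm v ^+ 2 - dot u v ^+ 2) =
  \sum_(i < d) \sum_(j < d)
    (u ord0 i * v ord0 j - u ord0 j * v ord0 i) ^+ 2.
  have -> : 2 * (enorm u ^+ 2 * enorm v ^+ 2 - dot u v ^+ 2) =
    enorm u ^+ 2 * enorm v ^+ 2 + enorm v ^+ 2 * enorm u ^+ 2
    + (- 2 * dot u v) * dot u v by ring.
  rewrite !enorm_sqr /dot [- 2 * _]mulr_sumr !big_distrlr -!big_split /=.
  apply: eq_bigr => i _; rewrite -!big_split /=.
  by apply: eq_bigr => j _; ring.
by do 2!apply: sumr_ge0 => ? _; exact: sqr_ge0.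
Qed.

Lemma dot_le u v : dot u v <= enorm u * enorm v.
Proof.
apply: le_trans (ler_norm _) _.
rewrite -ler_sqr ?nnegrE ?normr_ge0 ?mulr_ge0 ?enorm_ge0 //.
by rewrite exprMn real_normK ?num_real ?dot_sqr_le.
Qed.

Lemma enormB_sqr u v :
  enorm (u - v) ^+ 2 = enorm u ^+ 2 - 2 * dot u v + enorm v ^+ 2.
Proof.
rewrite !enorm_sqr /dot mulr_sumr -sumrB -big_split /=.
by apply: eq_bigr => j _; rewrite !mxE; ring.
Qed.

Lemma enormZ_sqr (a : R) u : enorm (a *: u) ^+ 2 = a ^+ 2 * enorm u ^+ 2.
Proof.
by rewrite !enorm_sqr mulr_sumr; apply: eq_bigr => j _; rewrite mxE exprMn.
Qed.

Lemma dotZr (a : R) u v : dot u (a *: v) = a * dot u v.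
Proof. by rewrite /dot mulr_sumr; apply: eq_bigr => j _; rewrite mxE; ring. Qed.

Lemma dotBl u v x : dot (u - v) x = dot u x - dot v x.
Proof.
by rewrite /dot -sumrB; apply: eq_bigr => j _; rewrite !mxE; ring.
Qed.

Lemma enormZ (a : R) u : 0 <= a -> enorm (a *: u) = a * enorm u.
Proof.
move=> a_ge0; apply/eqP; rewrite -(@eqrXn2 _ 2) ?mulr_ge0 ?enorm_ge0 //.
by rewrite enormZ_sqr exprMn.
Qed.

(** Induction step of |x_t - x_0|^2 <= eta^2 t (|v_0|^2 + ... + |v_(t-1)|^2).
    The cross term is bounded by its square: Cauchy-Schwarz leaves
    4 t Q |v|^2 <= (Q + t |v|^2)^2.  No division by t occurs, so that t = 0 is
    covered. *)
Lemma step_sqr_le (t : nat) (eta Q : R) u v :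
  0 <= Q -> enorm u ^+ 2 <= eta ^+ 2 * t%:R * Q ->
  enorm (u - eta *: v) ^+ 2 <= eta ^+ 2 * t.+1%:R * (Q + enorm v ^+ 2).
Proof.
move=> Q_ge0 uQ; rewrite enormB_sqr enormZ_sqr dotZr.
set q := enorm v ^+ 2; have q_ge0 : 0 <= q by exact: sqr_ge0.
have t_ge0 : (0 : R) <= t%:R by [].
have h : - 2 * (eta * dot u v) <= eta ^+ 2 * (Q + t%:R * q).
  apply: le_trans (ler_norm _) _.
  have rhs_ge0 : 0 <= eta ^+ 2 * (Q + t%:R * q).
    by rewrite mulr_ge0 ?sqr_ge0 // addr_ge0 // mulr_ge0.
  rewrite -ler_sqr ?nnegrE ?normr_ge0 //.
  rewrite real_normK ?num_real //.
  have := ler_wpM2l (sqr_ge0 eta) (dot_sqr_le u v); rewrite -/q => h1.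
  have h2 : eta ^+ 2 * (enorm u ^+ 2 * q) <= eta ^+ 2 * (eta ^+ 2 * t%:R * Q * q).
    by rewrite ler_wpM2l ?sqr_ge0 // ler_wpM2r.
  have h3 : 0 <= (eta ^+ 2) ^+ 2 * (Q - t%:R * q) ^+ 2.
    by rewrite mulr_ge0 ?sqr_ge0.
  have e3 : (eta ^+ 2) ^+ 2 * (Q - t%:R * q) ^+ 2
     = (eta ^+ 2 * (Q + t%:R * q)) ^+ 2
       - 4 * (eta ^+ 2 * (eta ^+ 2 * t%:R * Q * q)) by ring.
  have e4 : (- 2 * (eta * dot u v)) ^+ 2 = 4 * (eta ^+ 2 * dot u v ^+ 2) by ring.
  rewrite e4; lra.
rewrite -(natr1 t); lra.
Qed.
End Euclidean.

Section Gradient.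
Context (R : realType) (d : nat).
Implicit Types (x y u : 'rV[R]_d).

Lemma derive_grad (f : 'rV[R]_d -> R) x u :
  differentiable (f : 'rV[R]_d -> R^o) x ->
  'D_u (f : 'rV[R]_d -> R^o) x = dot (grad f x) u.
Proof.
move=> df; rewrite deriveE // {1}[u]row_sum_delta linear_sum /=.
apply: eq_bigr => j _.
by rewrite linearZ /= mxE deriveE // [RHS]mulrC.
Qed.

(** The difference quotients of f along the line are those of f at the point
    x + t u in the direction u. *)
Lemma is_derive_line (f : 'rV[R]_d -> R) x u (t : R) :
  (forall z, differentiable (f : 'rV[R]_d -> R^o) z) ->
  is_derive t 1 (fun s : R => f (x + s *: u) : R^o)
    (dot (grad f (x + t *: u)) u).
Proof.
move=> df; rewrite -derive_grad //.
have E : (fun h : R => h^-1 *: (((fun s : R => f (x + s *: u) : R^o) \o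
                               shift t) (h *: (1 : R)) - f (x + t *: u))) =
         (fun h : R => h^-1 *: (((f : 'rV[R]_d -> R^o) \o
                               shift (x + t *: u)) (h *: u) - f (x + t *: u))).
  apply: funext => h /=; congr (_ *: (f _ - _)).
  have -> : h *: (1 : R) = h by rewrite /GRing.scale /= mulr1.
  by rewrite scalerDl addrCA.
have D : derivable (f : 'rV[R]_d -> R^o) (x + t *: u) u.
  exact: diff_derivable.
by split; [rewrite /derivable E | rewrite /derive E].
Qed.

(** Apply the mean value theorem on [0, 1] to the difference of f and its
    quadratic model along the segment: its derivative at c is
    <grad f (x + c u) - grad f (x), u> - c L |u|^2, which is nonpositive by the
    Lipschitz bound. *)
Lemma descent (L : R) (f : 'rV[R]_d -> R) x y :
  (forall z, differentiable (f : 'rV[R]_d -> R^o) z) ->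
  (forall z w, enorm (grad f z - grad f w) <= L * enorm (z - w)) ->
  f y <= f x + dot (grad f x) (y - x) + L / 2 * enorm (y - x) ^+ 2.
Proof.
move=> df lip; set u := y - x.
pose psi (t : R) : R^o :=
  f (x + t *: u) - (t * dot (grad f x) u + t ^+ 2 * (L / 2 * enorm u ^+ 2)).
pose dpsi (t : R) : R :=
  dot (grad f (x + t *: u)) u - (dot (grad f x) u + t * (L * enorm u ^+ 2)).
have dpsiP (t : R) : is_derive t 1 psi (dpsi t).
  have D := is_derive_line x u t df.
  apply: is_derive_eq.
  rewrite /dpsi /GRing.scale /=; congr (_ - _).
  by field.
have cpsi : {within `[0, 1], continuous psi}.
  apply: derivable_within_continuous => s _.
  by have [] := dpsiP s.
have [c c01 psiE] := MVT (@ltr01 R) (fun t _ => dpsiP t) cpsi.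
have {c01} c_gt0 : 0 < c by move: c01; rewrite in_itv /= => /andP[].
have c_le : dpsi c <= 0.
  rewrite /dpsi opprD addrA -dotBl.
  have := dot_le (grad f (x + c *: u) - grad f x) u.
  have := ler_wpM2r (enorm_ge0 u) (lip (x + c *: u) x).
  by rewrite [x + _]addrC addrK enormZ ?(ltW c_gt0) //; lra.
move: psiE; rewrite /psi scale1r scale0r addr0 /u [x + _]addrC subrK -/u; lra.
Qed.

Lemma grad_mean_fun n (fs : 'I_n -> 'rV[R]_d -> R) x :
  (forall i z, differentiable (fs i : 'rV[R]_d -> R^o) z) ->
  grad (mean_fun fs) x = n%:R^-1 *: \sum_(i < n) grad (fs i) x.
Proof.
move=> df; apply/rowP => j; rewrite !mxE summxE.
have -> : mean_fun fs = n%:R^-1 \*: (\sum_(i < n) (fs i : 'rV[R]_d -> R^o)).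
  by apply: funext => z /=; rewrite fct_sumE.
have D i : derivable (fs i : 'rV[R]_d -> R^o) x (delta_mx ord0 j).
  exact: diff_derivable.
rewrite deriveZ; last exact: derivable_sum.
rewrite derive_sum //; congr (_ * _).
by apply: eq_bigr => i _; rewrite mxE.
Qed.

(** Average of the descent inequalities of the summands, which share L. *)
Lemma descent_mean n (L : R) (fs : 'I_n -> 'rV[R]_d -> R) x y :
  (0 < n)%N ->
  (forall i z, differentiable (fs i : 'rV[R]_d -> R^o) z) ->
  (forall i z w, enorm (grad (fs i) z - grad (fs i) w) <= L * enorm (z - w)) ->
  mean_fun fs y <= mean_fun fs x + dot (grad (mean_fun fs) x) (y - x)
                   + L / 2 * enorm (y - x) ^+ 2.
Proof.
move=> n_gt0 df lip.
have nz : n%:R != 0 :> R by rewrite pnatr_eq0 -lt0n.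
have -> : dot (grad (mean_fun fs) x) (y - x) =
          n%:R^-1 * \sum_(i < n) dot (grad (fs i) x) (y - x).
  rewrite grad_mean_fun // /dot exchange_big /= mulr_sumr.
  by apply: eq_bigr => j _; rewrite mxE summxE -mulrA mulr_suml.
have -> : L / 2 * enorm (y - x) ^+ 2 =
          n%:R^-1 * \sum_(i < n) (L / 2 * enorm (y - x) ^+ 2).
  by rewrite sumr_const card_ord -[X in _ = _ * X]mulr_natl mulKf.
rewrite /mean_fun -!mulrDr -!big_split /= ler_wpM2l ?invr_ge0 //.
by apply: ler_sum => i _; apply: descent; [exact: df | exact: lip].
Qed.
End Gradient.

(** * Processes driven by a tuple of independent choices *)

Lemma big_tuple_cons (R : realType) (T : finType) (k : nat)
    (F : k.+1.-tuple T -> R) :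
  \sum_(es : k.+1.-tuple T) F es =
  \sum_(e : T) \sum_(es : k.-tuple T) F [tuple of e :: es].
Proof.
rewrite pair_big /=.
rewrite (reindex (fun p : T * k.-tuple T => [tuple of p.1 :: p.2])) //=.
exists (fun es : k.+1.-tuple T => (thead es, [tuple of behead es])).
  by move=> [e es] _; congr pair; apply: val_inj.
by move=> es _; rewrite [RHS]tuple_eta.
Qed.

Lemma big_tuple0 (R : realType) (T : finType) (F : 0.-tuple T -> R) :
  \sum_(es : 0.-tuple T) F es = F [tuple].
Proof.
by rewrite (big_pred1 [tuple]) // => t; rewrite /= [t]tuple0; apply/esym/eqP.
Qed.

Section TupleProcess.
Context (R : realType) (X : Type) (T : finType) (step : X -> T -> X).
Implicit Types (st : X) (e : T).

Definition traj st (es : seq T) (s : nat) : X := foldl step st (take s es).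

Context (p : X -> T -> R).

(** Chain rule: p st e is the conditional probability of the choice e when
    the process is in the state st. *)
Definition path_prob k st (es : k.-tuple T) : R :=
  \prod_(s < k) p (traj st es s) (tnth es s).

(** The process restarted from its state after the first choice is a process of
    the same kind; every induction on the number of steps goes through this. *)
Lemma path_prob_cons k st e (es : k.-tuple T) :
  path_prob st [tuple of e :: es] = p st e * path_prob (step st e) es.
Proof.
rewrite /path_prob big_ord_recl /= (tnth_nth e) /=; congr (_ * _).
by apply: eq_bigr => s _; rewrite tnthS.
Qed.

Context (good : X -> Prop) (good_step : forall st e, good st -> good (step st e))
  (p_ge0 : forall st e, good st -> 0 <= p st e)
  (p_sum1 : forall st, good st -> \sum_e p st e = 1).

Lemma path_prob_sum1 k st : good st -> \sum_(es : k.-tuple T) path_prob st es = 1.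
Proof.
elim: k st => [|k IHk] st gst.
  rewrite big_tuple0.
  by rewrite /path_prob big_ord0.
rewrite big_tuple_cons -[RHS](p_sum1 gst); apply: eq_bigr => e _.
rewrite -[RHS]mulr1 -(IHk _ (good_step e gst)) mulr_sumr.
by apply: eq_bigr => es _; rewrite path_prob_cons.
Qed.

(** If in one step the mean of the gain h plus the potential grows by at most
    D, then the mean of the total gain plus the final potential is at most the
    initial potential plus D per step.  The law of the choice may depend on the
    state, and the hypotheses are only asked on an invariant set of states. *)
Lemma potential_bound (h : X -> T -> R) (Phi : X -> R) (D : R) :
  (forall st, good st ->
     \sum_e p st e * (h st e + Phi (step st e)) <= Phi st + D) ->
  forall k st, good st ->
  \sum_(es : k.-tuple T) path_prob st es *
     (\sum_(s < k) h (traj st es s) (tnth es s) + Phi (traj st es k))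
  <= Phi st + k%:R * D.
Proof.
move=> hstep; elim=> [|k IHk] st gst.
  rewrite big_tuple0.
  by rewrite /path_prob !big_ord0 /traj /= mul0r add0r mul1r addr0.
rewrite big_tuple_cons.
apply: (@le_trans _ _ (\sum_e p st e *
          (h st e + (Phi (step st e) + k%:R * D)))).
  apply: ler_sum => e _; have ge := good_step e gst.
  have := ler_wpM2l (p_ge0 e gst) (lerD (lexx (h st e)) (IHk _ ge)).
  apply: le_trans; rewrite le_eqVlt; apply/orP; left; apply/eqP.
  rewrite -[X in _ = _ * (X + _)]mulr1 -(path_prob_sum1 k ge) mulr_sumr -big_split mulr_sumr.
  apply: eq_bigr => es _; rewrite path_prob_cons big_ord_recl /= (tnth_nth e) /=.
  rewrite /traj /= (eq_bigr (fun s : 'I_k =>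
    h (foldl step (step st e) (take s es)) (tnth es s))).
    by ring.
  by move=> s _; rewrite tnthS.
under eq_bigr do rewrite addrA mulrDr.
rewrite big_split /= -mulr_suml p_sum1 // mul1r.
by have := hstep st gst; rewrite -(natr1 k); lra.
Qed.
End TupleProcess.

(** * Mini-batches and sampling without replacement *)

Section Sampling.
Context (R : realType).

(** Independent centred draws have additive variances.  The constant c is what
    makes the induction on the size work: the first draw is moved into it, and
    the cross term vanishes by centring. *)
Lemma minibatch_sum_sqr n B (z : 'I_n -> R) (c : R) : (0 < n)%N ->
  \sum_i z i = 0 ->
  \sum_(b : B.-tuple 'I_n) (n%:R ^+ B)^-1 * (c + \sum_(i <- b) z i) ^+ 2 =
  c ^+ 2 + B%:R * (n%:R^-1 * \sum_i z i ^+ 2).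
Proof.
move=> n_gt0 z0; have nz : n%:R != 0 :> R by rewrite pnatr_eq0 -lt0n.
elim: B c => [|B IHB] c.
  rewrite big_tuple0.
  by rewrite big_nil addr0 expr0 invr1 mul1r mul0r addr0.
rewrite big_tuple_cons.
under eq_bigr => i _.
  under eq_bigr => b _ do
    rewrite big_cons exprS invfM -mulrA addrA.
  rewrite -mulr_sumr IHB sqrrD -!addrA.
  over.
rewrite -mulr_sumr !big_split /= sumr_const card_ord.
rewrite -mulr_sumr z0 mulr0 !add0r sumr_const card_ord -(natr1 B).
by rewrite -[c ^+ 2 *+ n]mulr_natl -[(_ * _) *+ n]mulr_natl; field.
Qed.

Lemma minibatch_variance d n B (z : 'I_n -> 'rV[R]_d) (c : 'rV[R]_d) :
  (0 < n)%N -> (0 < B)%N -> \sum_i z i = 0 ->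
  \sum_(b : B.-tuple 'I_n)
     (n%:R ^+ B)^-1 * enorm (c + B%:R^-1 *: \sum_(i <- b) z i) ^+ 2 =
  enorm c ^+ 2 + B%:R^-1 * (n%:R^-1 * \sum_i enorm (z i) ^+ 2).
Proof.
move=> n_gt0 B_gt0 z0.
have Bz : B%:R != 0 :> R by rewrite pnatr_eq0 -lt0n.
have -> : \sum_i enorm (z i) ^+ 2 = \sum_j \sum_i z i ord0 j ^+ 2.
  by rewrite exchange_big; apply: eq_bigr => i _; rewrite enorm_sqr.
under eq_bigr do rewrite enorm_sqr mulr_sumr.
rewrite exchange_big /= enorm_sqr !mulr_sumr -big_split /=.
apply: eq_bigr => j _.
have z0j : \sum_i (B%:R^-1 * z i ord0 j) = 0.
  by rewrite -mulr_sumr -summxE z0 mxE mulr0.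
rewrite (eq_bigr (fun b : B.-tuple 'I_n => (n%:R ^+ B)^-1 *
    (c ord0 j + \sum_(i <- b) B%:R^-1 * z i ord0 j) ^+ 2)); last first.
  by move=> b _; rewrite -mulr_sumr 2!mxE summxE.
rewrite (minibatch_sum_sqr _ _ n_gt0 z0j).
rewrite [in LHS](eq_bigr (fun i => B%:R^-1 ^+ 2 * z i ord0 j ^+ 2)); last first.
  by move=> i _; rewrite exprMn.
rewrite -mulr_sumr; congr (_ + _).
by field; rewrite andbC Bz pnatr_eq0 -lt0n.
Qed.

(** Sampling without replacement is not worse than sampling with replacement.
    Let c i j count the subsets of size N that contain i and j.  By symmetry c
    is constant off the diagonal, say equal to k, and constant on it, with value
    N / |T| times the number of subsets by double counting.  As z is centred,
    the off-diagonal terms sum to - k sum_i z_i^2, which is nonpositive. *)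
Lemma subset_sum_sqr (T : finType) (N : nat) (z : T -> R) : \sum_i z i = 0 ->
  #|T|%:R * \sum_(A : {set T} | #|A| == N) (\sum_(i in A) z i) ^+ 2 <=
  N%:R * 'C(#|T|, N)%:R * \sum_i z i ^+ 2.
Proof.
move=> z0.
pose c (i j : T) : R :=
  \sum_(A : {set T} | #|A| == N) ((i \in A)%:R * (j \in A)%:R).
have c_perm (s : {perm T}) i j : c (s i) (s j) = c i j.
  rewrite /c (reindex (fun A : {set T} => s @: A)) /=; last first.
    exists (fun A : {set T} => s^-1%g @: A) => A _.
      by rewrite -imset_comp (eq_imset _ (permK s)) imset_id.
    by rewrite -imset_comp (eq_imset _ (permKV s)) imset_id.
  apply: eq_big => [A|A _]; first by rewrite card_imset //; exact: perm_inj.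
  by rewrite !mem_imset //; exact: perm_inj.
have c_diag i j : c i i = c j j.
  by rewrite -(c_perm (tperm i j) i i) tpermL.
have c_off i j k l : i != j -> k != l -> c i j = c k l.
  (* A permutation sending i to k and j to l. *)
  move=> ij kl; pose s := (tperm i k * tperm (tperm i k j) l)%g.
  rewrite -(c_perm s i j) /s !permM tpermL [X in c _ X]tpermL.
  rewrite tpermD //; last by rewrite eq_sym.
  by rewrite -[X in _ == X](tpermL i k) (inj_eq perm_inj) eq_sym.
have c_ge0 i j : 0 <= c i j by apply: sumr_ge0 => A _; rewrite mulr_ge0.
have sqrE : \sum_(A : {set T} | #|A| == N) (\sum_(i in A) z i) ^+ 2 =
  \sum_i \sum_j z i * z j * c i j.
  under eq_bigr => A _ do rewrite big_mkcond expr2 big_distrlr /=.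
  rewrite exchange_big /=; apply: eq_bigr => i _.
  rewrite exchange_big /=; apply: eq_bigr => j _.
  rewrite /c mulr_sumr; apply: eq_bigr => A _.
  by case: (i \in A); case: (j \in A); rewrite ?mulr1 ?mulr0 ?mul0r ?mulr0.
have count i : #|T|%:R * c i i = N%:R * 'C(#|T|, N)%:R.
  transitivity (\sum_(j : T) c j j).
    by under eq_bigr do rewrite (c_diag _ i); rewrite sumr_const -[RHS]mulr_natl.
  rewrite /c exchange_big /=.
  rewrite (eq_bigr (fun _ => N%:R)) => [|A /eqP <-]; last first.
    rewrite -sum1_card natr_sum [RHS]big_mkcond /=.
    by apply: eq_bigr => j _; case: (j \in A); rewrite ?mulr1 ?mulr0.
  by rewrite sumr_const -card_draws -[LHS]mulr_natr; congr (_ * _%:R);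
     apply: eq_card => A; rewrite inE.
rewrite sqrE mulr_sumr mulr_sumr.
have [k [g_ge0 off]] : exists k, 0 <= k /\ forall i j, i != j -> c i j = k.
  case: (pickP (fun ij : T * T => ij.1 != ij.2)) => [[k l] /= kl|none].
    by exists (c k l); split=> // i j ij; exact: c_off.
  by exists 0; split=> // i j ij; have := none (i, j); rewrite /= ij.
(* Centring turns the sum over the j other than i into - z i. *)
have row i : \sum_j z i * z j * c i j = z i ^+ 2 * (c i i - k).
  rewrite (bigD1 i) //= (eq_bigr (fun j => z i * k * z j)) => [|j ji].
    have := z0; rewrite (bigD1 i) //= => /eqP; rewrite addrC addr_eq0 => /eqP e.
    by rewrite -mulr_sumr e; ring.
  by rewrite (off i j) 1?eq_sym //; ring.
apply: ler_sum => i _; rewrite row -(count i).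
rewrite [X in X <= _]mulrCA [X in _ <= X]mulrC; apply: ler_wpM2l.
  exact: sqr_ge0.
by apply: ler_wpM2l => //; rewrite gerBl.
Qed.
End Sampling.

Section VectorSampling.
Context (R : realType) (d n : nat).
Implicit Types (a z : 'I_n -> 'rV[R]_d).

Lemma centered_sum0 a : \sum_i (a i - n%:R^-1 *: \sum_k a k) = 0.
Proof.
rewrite sumrB sumr_const card_ord -(scaler_nat n (n%:R^-1 *: _)) scalerA.
case: n a => [|k] a; first by rewrite !big_ord0 scaler0 subr0.
by rewrite divff ?pnatr_eq0 // scale1r subrr.
Qed.

(** The mean minimises the sum of squared distances. *)
Lemma centered_sum_sqr_le a :
  \sum_i enorm (a i - n%:R^-1 *: \sum_k a k) ^+ 2 <= \sum_i enorm (a i) ^+ 2.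
Proof.
set c := n%:R^-1 *: _.
have c0 : \sum_i dot (a i - c) c = 0.
  rewrite /dot exchange_big /= big1 // => j _.
  by rewrite -mulr_suml -summxE centered_sum0 mxE mul0r.
have E i : enorm (a i - c) ^+ 2 =
           enorm (a i) ^+ 2 - 2 * dot (a i - c) c - enorm c ^+ 2.
  have cc : dot c c = enorm c ^+ 2.
    by rewrite enorm_sqr; apply: eq_bigr => j _; rewrite expr2.
  by rewrite enormB_sqr dotBl cc; ring.
under eq_bigr do rewrite E.
rewrite !sumrB -mulr_sumr c0 mulr0 subr0 gerBl.
by apply: sumr_ge0 => i _; exact: sqr_ge0.
Qed.

Lemma subset_sum_enorm_sqr N z : \sum_i z i = 0 ->
  n%:R * \sum_(A : {set 'I_n} | #|A| == N) enorm (\sum_(i in A) z i) ^+ 2 <=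
  N%:R * 'C(n, N)%:R * \sum_i enorm (z i) ^+ 2.
Proof.
move=> z0.
under eq_bigr do rewrite enorm_sqr.
under [X in _ <= _ * X]eq_bigr do rewrite enorm_sqr.
rewrite exchange_big [X in _ <= _ * X]exchange_big /= !mulr_sumr.
apply: ler_sum => j _.
have z0j : \sum_i z i ord0 j = 0 by rewrite -summxE z0 mxE.
have := subset_sum_sqr N z0j; rewrite card_ord; apply: le_trans.
by under eq_bigr do rewrite summxE.
Qed.
End VectorSampling.

(** * One epoch *)

Section Epoch.
Context (R : realType) (d n m B : nat) (fs : 'I_n -> 'rV[R]_d -> R)
  (L sigma eta : R).
Context (n_gt0 : (0 < n)%N) (B_gt0 : (0 < B)%N) (m_gt0 : (0 < m)%N)
  (mB : (m ^ 2 <= 2 * B)%N) (L_gt0 : 0 < L) (eta_def : eta = 1 / (4 * L))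
  (fs_diff : forall i x, differentiable (fs i : 'rV[R]_d -> R^o) x)
  (fs_lip : forall i x y,
     enorm (grad (fs i) x - grad (fs i) y) <= L * enorm (x - y))
  (fs_var : forall x,
     n%:R^-1 * \sum_(i < n) enorm (grad (fs i) x - grad (mean_fun fs) x) ^+ 2
       <= sigma ^+ 2).
Local Notation f := (mean_fun fs).
Implicit Types (x xt g : 'rV[R]_d).

Lemma minibatch_mass : \sum_(b : B.-tuple 'I_n) (n%:R ^+ B)^-1 = 1 :> R.
Proof.
rewrite sumr_const card_tuple card_ord -[LHS]mulr_natl natrX divff //.
by rewrite expf_neq0 // pnatr_eq0 -lt0n.
Qed.

(** The error v - grad f (x) is the outer error, fixed in the epoch, plus the
    average over the mini-batch of centred vectors, of size at most
    L |x - xt| in quadratic mean because each gradient is Lipschitz. *)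
Lemma vr_grad_variance xt g x :
  \sum_(b : B.-tuple 'I_n)
     (n%:R ^+ B)^-1 * enorm (vr_grad fs xt g b x - grad f x) ^+ 2
  <= enorm (g - grad f xt) ^+ 2 + L ^+ 2 * B%:R^-1 * enorm (x - xt) ^+ 2.
Proof.
have Bz : B%:R != 0 :> R by rewrite pnatr_eq0 -lt0n.
have nz : n%:R != 0 :> R by rewrite pnatr_eq0 -lt0n.
pose a i := grad (fs i) x - grad (fs i) xt.
pose z i := a i - n%:R^-1 *: \sum_k a k.
have aE : n%:R^-1 *: \sum_k a k = grad f x - grad f xt.
  by rewrite !grad_mean_fun // -scalerBr -sumrB.
have E (b : B.-tuple 'I_n) : vr_grad fs xt g b x - grad f x =
    (g - grad f xt) + B%:R^-1 *: \sum_(i <- b) z i.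
  rewrite /z sumrB big_const_seq count_predT size_tuple iter_addr_0 aE.
  rewrite scalerBr -(scaler_nat B (grad f x - _)) scalerA mulVf // scale1r sumrB scalerBr.
  rewrite /vr_grad /avg_grad size_tuple.
  by apply/rowP => j; rewrite !mxE; ring.
under eq_bigr do rewrite E.
rewrite (minibatch_variance _ n_gt0 B_gt0 (centered_sum0 a)) lerD2l.
rewrite [L ^+ 2 * _]mulrC -mulrA ler_wpM2l ?invr_ge0 //.
have -> : L ^+ 2 * enorm (x - xt) ^+ 2 =
          n%:R^-1 * \sum_(i < n) (L * enorm (x - xt)) ^+ 2.
  by rewrite sumr_const card_ord -[X in _ = _ * X]mulr_natl mulKf // exprMn.
rewrite ler_wpM2l ?invr_ge0 //; apply: le_trans (centered_sum_sqr_le a) _.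
apply: ler_sum => i _; apply: lerXn2r; rewrite ?nnegrE ?enorm_ge0 ?fs_lip //.
by rewrite mulr_ge0 ?enorm_ge0 // ltW.
Qed.

(** State of the inner loop: step counter, current point, and the sum of the
    squared norms of the directions taken so far. *)
Definition inner_step xt g (st : nat * 'rV[R]_d * R) (b : B.-tuple 'I_n) :=
  let v := vr_grad fs xt g b st.1.2 in
  (st.1.1.+1, st.1.2 - eta *: v, st.2 + enorm v ^+ 2).

(** Coefficient of the sum of squared directions in the potential.  It starts
    from the 3 / 4 granted by the descent inequality, and step t consumes
    t / (16 B), the coefficient of the drift term
    (L^2 / B) eta^2 t Q at eta = 1 / (4 L). *)
Definition drift_coef (t : nat) : R :=
  3 / 4 - t%:R * (t%:R - 1) / (32 * B%:R).

Definition inner_potential (st : nat * 'rV[R]_d * R) : R :=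
  2 / eta * f st.1.2 + drift_coef st.1.1 * st.2.

Definition inner_good xt (st : nat * 'rV[R]_d * R) : Prop :=
  0 <= st.2 /\ enorm (st.1.2 - xt) ^+ 2 <= eta ^+ 2 * st.1.1%:R * st.2.

Lemma drift_coef_le t : drift_coef t <= 3 / 4.
Proof.
rewrite /drift_coef gerBl divr_ge0 //.
case: t => [|t]; first by rewrite mul0r.
by rewrite -natr1 addrK mulr_ge0 // addr_ge0.
Qed.

Lemma drift_coefS t : drift_coef t.+1 + t%:R / (16 * B%:R) = drift_coef t.
Proof.
rewrite /drift_coef -(natr1 t); field.
by rewrite pnatr_eq0 -lt0n.
Qed.

(** The drift consumes m (m - 1) / (32 B) <= 1 / 16 in the whole epoch, so that
    the 1 / 8 required by the outer potential remains. *)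
Lemma drift_coef_m : 1 / 8 <= drift_coef m.
Proof.
have B0 : 0 < B%:R :> R by rewrite ltr0n.
have : m%:R * (m%:R - 1) / (32 * B%:R) <= 1 / 16 :> R.
  rewrite ler_pdivrMr ?mulr_gt0 //.
  have : (m ^ 2)%:R <= (2 * B)%:R :> R by rewrite ler_nat.
  rewrite natrX natrM; have : 0 <= m%:R :> R by [].
  lra.
rewrite /drift_coef; lra.
Qed.

Lemma eta_gt0 : 0 < eta.
Proof. by rewrite eta_def divr_gt0 // mulr_gt0. Qed.

Lemma inner_good_step xt g st b :
  inner_good xt st -> inner_good xt (inner_step xt g st b).
Proof.
case: st => [[t x] Q] [/= Q_ge0 xQ]; split=> /=.
  by rewrite addr_ge0 ?sqr_ge0.
by rewrite addrAC; exact: step_sqr_le.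
Qed.

(** Descent inequality, then expectation over the mini-batch: by
    [drift_coefS] the decrease of the coefficient pays exactly for the drift. *)
Lemma inner_step_bound xt g st : inner_good xt st ->
  \sum_(b : B.-tuple 'I_n) (n%:R ^+ B)^-1 *
     (enorm (grad f st.1.2) ^+ 2 + inner_potential (inner_step xt g st b))
  <= inner_potential st + enorm (g - grad f xt) ^+ 2.
Proof.
case: st => [[t x] Q] [/= Q_ge0 xQ].
rewrite /inner_potential /=.
have eta0 := eta_gt0.
have etaL : eta * L = 1 / 4 by rewrite eta_def; field; rewrite gt_eqF.
set K := 2 / eta * f x + drift_coef t.+1 * Q.
apply: (@le_trans _ _ (\sum_(b : B.-tuple 'I_n) (n%:R ^+ B)^-1 *
     (K + enorm (vr_grad fs xt g b x - grad f x) ^+ 2))).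
  apply: ler_sum => b _; rewrite ler_wpM2l ?invr_ge0 ?exprn_ge0 //.
  set v := vr_grad fs xt g b x; rewrite /K.
  (* Pathwise part; the square |v - grad f x|^2 is expanded, and its cross
     term is the linear term of the descent inequality. *)
  have := descent_mean x (x - eta *: v) n_gt0 fs_diff fs_lip.
  have -> : x - eta *: v - x = (- eta) *: v by rewrite addrC addKr scaleNr.
  rewrite dotZr enormZ_sqr => desc.
  have := ler_wpM2l (ltW (divr_gt0 (ltr0n R 2) eta0)) desc.
  rewrite !mulrDr.
  have -> : 2 / eta * (- eta * dot (grad f x) v) = - 2 * dot (grad f x) v.
    by field; rewrite gt_eqF.
  have -> : 2 / eta * (L / 2 * ((- eta) ^+ 2 * enorm v ^+ 2)) =
            eta * L * enorm v ^+ 2 by field; rewrite gt_eqF.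
  rewrite etaL.
  have -> : v - grad f x = - (grad f x - v) by rewrite opprB.
  have -> : enorm (- (grad f x - v)) ^+ 2 = enorm (grad f x - v) ^+ 2.
    by rewrite -scaleN1r enormZ_sqr sqrrN expr1n mul1r.
  rewrite enormB_sqr.
  have := ler_wpM2r (sqr_ge0 (enorm v)) (drift_coef_le t.+1).
  lra.
under eq_bigr do rewrite mulrDr.
rewrite big_split /= -mulr_suml minibatch_mass mul1r.
have := vr_grad_variance xt g x.
have B0 : 0 < B%:R :> R by rewrite ltr0n.
have : L ^+ 2 * B%:R^-1 * enorm (x - xt) ^+ 2 <= t%:R / (16 * B%:R) * Q.
  have -> : t%:R / (16 * B%:R) * Q =
            L ^+ 2 * B%:R^-1 * (eta ^+ 2 * t%:R * Q).
    by rewrite eta_def; field; rewrite !gt_eqF.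
  by rewrite ler_wpM2l // mulr_ge0 ?sqr_ge0 ?invr_ge0 // ltW.
rewrite /K -(drift_coefS t); lra.
Qed.

Lemma inner_trajE xt (e : epoch_sample n m B) t : (t <= m)%N ->
  traj (inner_step xt (outer_grad fs xt e)) (0%N, xt, 0) e.2 t =
  (t, inner_iter fs eta xt e t,
   \sum_(i < m | (i < t)%N) enorm (inner_dir fs eta xt e i) ^+ 2).
Proof.
rewrite /traj /inner_iter; elim: t => [|t IHt] tm.
  by rewrite take0 big_pred0.
have b0 := tnth e.2 (Ordinal tm).
have st : (t < size e.2)%N by rewrite size_tuple.
rewrite (take_nth b0 st) !foldl_rcons IHt 1?ltnW // /inner_step /=.
congr (_, _, _).
rewrite [RHS](bigD1 (Ordinal tm)) //= [RHS]addrC; congr (_ + _); last first.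
  by rewrite /inner_dir (tnth_nth b0) /inner_iter.
apply: eq_bigl => i; rewrite ltnS [RHS]andbC ltn_neqAle.
by rewrite -val_eqE.
Qed.

(** One inner loop for a fixed outer sample A.  The incoming beta is set to 0
    because an epoch computes the outgoing one afresh. *)
Lemma inner_loop_bound xt (A : {set 'I_n}) :
  \sum_(bs : m.-tuple (B.-tuple 'I_n)) \prod_(t < m) (n%:R ^+ B)^-1 *
     (\sum_(t < m) enorm (grad f (inner_iter fs eta xt (A, bs) t)) ^+ 2
      + (2 / eta * f (epoch_step fs eta (xt, 0) (A, bs)).1
         + m%:R / 8 * (epoch_step fs eta (xt, 0) (A, bs)).2))
  <= 2 / eta * f xt
     + m%:R * enorm (avg_grad fs (enum A) xt - grad f xt) ^+ 2.
Proof.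
set g := avg_grad fs (enum A) xt.
have p_ge0 (st : nat * 'rV[R]_d * R) (b : B.-tuple 'I_n) :
  inner_good xt st -> 0 <= (n%:R ^+ B)^-1 :> R.
  by rewrite invr_ge0 exprn_ge0.
have good0 : inner_good xt (0%N, xt, 0).
  by rewrite /inner_good /= subrr mulr0 -(scale0r xt) enormZ_sqr expr2 !mul0r.
have := potential_bound (@inner_good_step xt g) p_ge0
  (fun _ _ => minibatch_mass) (@inner_step_bound xt g) m good0.
rewrite /inner_potential /= mulr0 addr0; apply: le_trans.
apply: ler_sum => bs _; rewrite /path_prob ler_wpM2l //.
  by rewrite prodr_ge0 // => t _; rewrite invr_ge0 exprn_ge0.
have trajE t := @inner_trajE xt (A, bs) t.
apply: lerD.
  by apply: ler_sum => t _; rewrite (trajE t) //= ltnW.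
rewrite (trajE m) //= lerD2l.
have m_nz : m%:R != 0 :> R by rewrite pnatr_eq0 -lt0n.
rewrite (_ : m%:R / 8 * _ =
  1 / 8 * \sum_(t < m) enorm (inner_dir fs eta xt (A, bs) t) ^+ 2); last first.
  by field.
rewrite (eq_bigl xpredT) => [|t]; last by rewrite ltn_ord.
by rewrite ler_wpM2r ?drift_coef_m // sumr_ge0 // => t _; exact: sqr_ge0.
Qed.

(** Uniform law on the subsets of size N. *)
Definition outer_prob (N : nat) (A : {set 'I_n}) : R :=
  (#|A| == N)%:R / 'C(n, N)%:R.

Lemma outer_prob_ge0 N A : 0 <= outer_prob N A.
Proof. by rewrite divr_ge0. Qed.

Lemma outer_expectE N (F : {set 'I_n} -> R) :
  \sum_A outer_prob N A * F A =
  'C(n, N)%:R^-1 * \sum_(A : {set 'I_n} | #|A| == N) F A.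
Proof.
rewrite mulr_sumr [RHS]big_mkcond; apply: eq_bigr => A _.
by rewrite /outer_prob; case: eqP => _; rewrite ?mul0r ?mul1r.
Qed.

Lemma outer_prob_sum1 N : (N <= n)%N -> \sum_A outer_prob N A = 1.
Proof.
move=> Nn; rewrite -(eq_bigr _ (fun A _ => mulr1 (outer_prob N A))).
rewrite outer_expectE sumr_const.
have -> : #|[pred A : {set 'I_n} | #|A| == N]| = 'C(n, N).
  rewrite -[in RHS](card_ord n) -card_draws; by apply: eq_card => A; rewrite !inE.
by rewrite mulVf // pnatr_eq0 -lt0n bin_gt0.
Qed.

(** For N = n the outer estimate is the full gradient, so that the error
    vanishes; otherwise sampling without replacement does not exceed the
    variance of N independent draws. *)
Lemma outer_variance N xt : (0 < N <= n)%N ->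
  \sum_A outer_prob N A * enorm (avg_grad fs (enum A) xt - grad f xt) ^+ 2
  <= if N == n then 0 else sigma ^+ 2 / N%:R.
Proof.
move=> /andP[N_gt0 Nn].
have N0 : 0 < N%:R :> R by rewrite ltr0n.
have n0 : 0 < n%:R :> R by rewrite ltr0n.
have C0 : 0 < 'C(n, N)%:R :> R by rewrite ltr0n bin_gt0.
pose z i := grad (fs i) xt - n%:R^-1 *: \sum_k grad (fs k) xt.
have E (A : {set 'I_n}) : #|A| = N ->
    enorm (avg_grad fs (enum A) xt - grad f xt) ^+ 2 =
    N%:R^-1 ^+ 2 * enorm (\sum_(i in A) z i) ^+ 2.
  move=> AN; rewrite -enormZ_sqr; congr (enorm _ ^+ 2).
  rewrite sumrB sumr_const AN scalerBr -(scaler_nat N (n%:R^-1 *: _)).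
  rewrite scalerK ?gt_eqF // grad_mean_fun // /avg_grad -cardE AN.
  by rewrite big_enum.
rewrite outer_expectE (eq_bigr _ (fun A AN => E A (eqP AN))) -mulr_sumr.
case: eqP => [Nn_eq|_].
  rewrite big1 ?mulr0 // => A; rewrite Nn_eq => /eqP An.
  have -> : A = finset.setTfor 'I_n.
    by apply/eqP; rewrite eqEcard finset.subsetT finset.cardsT card_ord An leqnn.
  rewrite (eq_bigl xpredT) => [|i]; last by rewrite inE.
  by rewrite centered_sum0 -(scale0r 0) enormZ_sqr expr0n mul0r.
have := subset_sum_enorm_sqr N (centered_sum0 (fun i => grad (fs i) xt)).
set V := \sum_(A : {set 'I_n} | _) _ => hV.
have hs := fs_var xt; rewrite grad_mean_fun // in hs.
rewrite ler_pdivrMl // in hs.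
have {hs}hV : n%:R * V <= n%:R * (N%:R * 'C(n, N)%:R * sigma ^+ 2).
  apply: le_trans hV _.
  by rewrite [X in _ <= X]mulrCA ler_wpM2l // mulr_ge0 // ltW.
rewrite ler_pM2l // in hV.
have -> : sigma ^+ 2 / N%:R = 'C(n, N)%:R^-1 * (N%:R^-1 ^+ 2 *
   (N%:R * 'C(n, N)%:R * sigma ^+ 2)) by field; rewrite !gt_eqF.
by rewrite !ler_wpM2l ?invr_ge0 ?sqr_ge0 // ltW.
Qed.

(** Average of the inner loop over the outer sample: D bounds the variance of
    the outer estimate. *)
Lemma epoch_bound N (st : 'rV[R]_d * R) (D : R) : (0 < N <= n)%N ->
  (if N == n then 0 else sigma ^+ 2 / N%:R) <= D ->
  \sum_(e : epoch_sample n m B)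
     (outer_prob N e.1 * \prod_(t < m) (n%:R ^+ B)^-1) *
     (\sum_(t < m) enorm (grad f (inner_iter fs eta st.1 e t)) ^+ 2
      + (2 / eta * f (epoch_step fs eta st e).1
         + m%:R / 8 * (epoch_step fs eta st e).2))
  <= 2 / eta * f st.1 + m%:R * D.
Proof.
move=> N_bnd varD.
rewrite -(pair_bigA _ (fun A bs => (outer_prob N A * \prod_(t < m) (n%:R ^+ B)^-1) *
     (\sum_(t < m) enorm (grad f (inner_iter fs eta st.1 (A, bs) t)) ^+ 2
      + (2 / eta * f (epoch_step fs eta st (A, bs)).1
         + m%:R / 8 * (epoch_step fs eta st (A, bs)).2)))) /=.
apply: (@le_trans _ _ (\sum_A outer_prob N A * (2 / eta * f st.1
     + m%:R * enorm (avg_grad fs (enum A) st.1 - grad f st.1) ^+ 2))).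
  apply: ler_sum => A _; under eq_bigr do rewrite -mulrA.
  by rewrite -mulr_sumr ler_wpM2l ?outer_prob_ge0 ?inner_loop_bound.
under eq_bigr do rewrite mulrDr [X in _ + X]mulrCA.
rewrite big_split /= -mulr_suml -mulr_sumr outer_prob_sum1; last first.
  by case/andP: N_bnd.
by rewrite mul1r lerD2l ler_wpM2l // (le_trans (outer_variance _ N_bnd)).
Qed.
End Epoch.

(** * Rounded batch sizes *)

Section Rounding.
Context (R : realType) (rnd : R -> nat) (rndP : is_rounding rnd).
Implicit Types (x : R).

(** The lower bound holds for small x because a rounding is never 0, and for
    x >= 2 because then x - 1 >= x / 2. *)
Lemma rnd_bounds x : 0 < x -> x / 2 <= (rnd x)%:R /\ (rnd x)%:R < x + 1.
Proof.
move=> x_gt0; have [r_gt0] := rndP x_gt0; rewrite ltr_norml => /andP[lo hi].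
have r_ge1 : 1 <= (rnd x)%:R :> R by rewrite ler1n.
by split; lra.
Qed.

Lemma rnd_le_nat x k : 0 < x -> x <= k%:R -> (rnd x <= k)%N.
Proof.
move=> x_gt0 xk; have [_ hi] := rnd_bounds x_gt0.
rewrite -ltnS -(ltr_nat R) -natr1; lra.
Qed.

Lemma rnd_nat k : (0 < k)%N -> rnd k%:R = k.
Proof.
move=> k_gt0; have k0 : 0 < k%:R :> R by rewrite ltr0n.
apply/eqP; rewrite eqn_leq rnd_le_nat //= -ltnS -(ltr_nat R) -natr1.
have [_] := rndP k0; rewrite ltr_norml => /andP[lo _]; lra.
Qed.

(** Rounding costs a factor 2: k + 1 < sqrt B + 1 gives k^2 + 1 <= B, and
    (k + 1)^2 <= 2 (k^2 + 1). *)
Lemma rnd_sqrt_sqr B : (0 < B)%N -> (rnd (Num.sqrt B%:R) ^ 2 <= 2 * B)%N.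
Proof.
move=> B_gt0; have sB : 0 < Num.sqrt B%:R :> R by rewrite sqrtr_gt0 ltr0n.
have [r_gt0 _] := rndP sB; have [_] := rnd_bounds sB.
move: r_gt0; case: (rnd _) => // k _; rewrite -natr1 ltrD2r => kB.
have : (k ^ 2 < B)%N.
  rewrite -(ltr_nat R) natrX -[X in _ < X]sqr_sqrtr //.
  by rewrite ltrXn2r // nnegrE ltW.
by move=> kB2; have := leq0n k; nia.
Qed.
End Rounding.

Section BatchSize.
Context (R : realType) (cbeta ceps sigma eps : R) (n : nat).
Context (sigma_gt0 : 0 < sigma) (eps_gt0 : 0 < eps) (n_gt0 : (0 < n)%N)
  (cbeta_ge16 : 16 <= cbeta) (ceps_ge16 : 16 <= ceps).
Local Notation size_of := (aba_size cbeta ceps sigma eps n).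
Implicit Types (b : R).

Lemma svrg_size_gt0 : 0 < svrg_size ceps sigma eps n.
Proof.
rewrite lt_min ltr0n n_gt0 andbT !mulr_gt0 ?invr_gt0 ?exprn_gt0 //.
exact: lt_le_trans ceps_ge16.
Qed.

Lemma aba_size_le_svrg b : size_of b <= svrg_size ceps sigma eps n.
Proof. by rewrite /aba_size; case: eqP => // _; rewrite ge_min lexx orbT. Qed.

Lemma aba_size_gt0 b : 0 <= b -> 0 < size_of b.
Proof.
move=> b_ge0; rewrite /aba_size; case: eqP => [_|/eqP b_nz].
  exact: svrg_size_gt0.
rewrite lt_min svrg_size_gt0 andbT !mulr_gt0 ?invr_gt0 ?exprn_gt0 //.
  exact: lt_le_trans cbeta_ge16.
by rewrite lt_def b_nz.
Qed.

Lemma aba_size_lt_svrg b : 0 <= b ->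
  (size_of b < svrg_size ceps sigma eps n) =
  (0 < b) && (cbeta * sigma ^+ 2 / b < svrg_size ceps sigma eps n).
Proof.
move=> b_ge0; rewrite /aba_size [0 < b]lt_def b_ge0 andbT.
by case: eqP => _ /=; rewrite ?ltxx // gt_min ltxx orbF.
Qed.

(** The minimum is attained by n or by one of the two statistical sizes; each
    of these, even when halved, is large enough for the variance
    (b + eps) / 8, because cbeta and ceps are at least 16. *)
Lemma aba_size_cases b : 0 <= b ->
  size_of b = n%:R \/ sigma ^+ 2 <= (b + eps) / 8 * (size_of b / 2).
Proof.
move=> b_ge0.
have s0 : 0 < sigma ^+ 2 by rewrite exprn_gt0.
have rate_ge0 c y : 16 <= c -> 0 <= y -> 0 <= c / 16 * sigma ^+ 2 / y.
  move=> c16 y_ge0; rewrite divr_ge0 // mulr_ge0 ?(ltW s0) // divr_ge0 //.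
  exact: le_trans c16.
have svrg : svrg_size ceps sigma eps n = n%:R \/
    sigma ^+ 2 <= (b + eps) / 8 * (svrg_size ceps sigma eps n / 2).
  rewrite /svrg_size minElt; case: ifP => _; [right | by left].
  have -> : (b + eps) / 8 * (ceps * sigma ^+ 2 * eps^-1 / 2) =
    ceps / 16 * sigma ^+ 2 + b * (ceps / 16 * sigma ^+ 2 / eps).
    by field; rewrite gt_eqF.
  have : 0 <= b * (ceps / 16 * sigma ^+ 2 / eps).
    by rewrite mulr_ge0 // rate_ge0 // ltW.
  have := ler_wpM2r (ltW s0) ceps_ge16; lra.
rewrite /aba_size; case: eqP => [_|/eqP b_nz]; first exact: svrg.
have b_gt0 : 0 < b by rewrite lt_def b_nz.
rewrite minElt; case: ifP => _; [right | exact: svrg].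
have -> : (b + eps) / 8 * (cbeta * sigma ^+ 2 / b / 2) =
    cbeta / 16 * sigma ^+ 2 + eps * (cbeta / 16 * sigma ^+ 2 / b).
  by field.
have : 0 <= eps * (cbeta / 16 * sigma ^+ 2 / b).
  by rewrite mulr_ge0 ?rate_ge0 // ltW.
have := ler_wpM2r (ltW s0) cbeta_ge16; lra.
Qed.

(** The bound on the variance of the outer estimate that the epoch potential
    needs; halving the size accounts for the rounding. *)
Lemma aba_batch_variance (rnd : R -> nat) b : is_rounding rnd -> 0 <= b ->
  (0 < rnd (size_of b) <= n)%N /\
  (if rnd (size_of b) == n then 0 else sigma ^+ 2 / (rnd (size_of b))%:R)
    <= (b + eps) / 8.
Proof.
move=> rndP b_ge0; have x_gt0 := aba_size_gt0 b_ge0.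
have [r_gt0 _] := rndP _ x_gt0; have [half _] := rnd_bounds rndP x_gt0.
have D_gt0 : 0 < (b + eps) / 8 by rewrite divr_gt0 // ltr_wpDl.
split.
  rewrite r_gt0 rnd_le_nat //; apply: le_trans (aba_size_le_svrg b) _.
  by rewrite /svrg_size ge_min lexx orbT.
case: eqP => [_|r_ne]; first exact: ltW.
have [x_eq|x_ge] := aba_size_cases b_ge0.
  by case: r_ne; rewrite x_eq rnd_nat.
rewrite ler_pdivrMr ?ltr0n //; apply: le_trans x_ge _.
by rewrite ler_wpM2l // ltW.
Qed.
End BatchSize.

(** * The whole run *)

Section Run.
Context (R : realType) (d n m B S : nat) (fs : 'I_n -> 'rV[R]_d -> R)
  (L sigma eps eta cbeta ceps : R) (rnd : R -> nat).
Context (n_gt0 : (0 < n)%N) (B_gt0 : (0 < B)%N) (m_gt0 : (0 < m)%N)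
  (S_gt0 : (0 < S)%N)
  (mB : (m ^ 2 <= 2 * B)%N) (L_gt0 : 0 < L) (eta_def : eta = 1 / (4 * L))
  (sigma_gt0 : 0 < sigma) (eps_gt0 : 0 < eps)
  (cbeta_ge16 : 16 <= cbeta) (ceps_ge16 : 16 <= ceps) (rndP : is_rounding rnd)
  (fs_diff : forall i x, differentiable (fs i : 'rV[R]_d -> R^o) x)
  (fs_lip : forall i x y,
     enorm (grad (fs i) x - grad (fs i) y) <= L * enorm (x - y))
  (f_lb : has_lbound (range (mean_fun fs)))
  (fs_var : forall x,
     n%:R^-1 * \sum_(i < n) enorm (grad (fs i) x - grad (mean_fun fs) x) ^+ 2
       <= sigma ^+ 2).
Local Notation f := (mean_fun fs).
Local Notation N := (fun b : R => rnd (aba_size cbeta ceps sigma eps n b)).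

Lemma epoch_step_beta_ge0 (st : 'rV[R]_d * R) (e : epoch_sample n m B) :
  0 <= (epoch_step fs eta st e).2.
Proof. by rewrite mulr_ge0 ?invr_ge0 // sumr_ge0 // => t _; exact: sqr_ge0. Qed.

Lemma beta_ge0 x0 beta1 (w : run n m B S) (s : nat) : 0 <= beta1 ->
  0 <= beta fs eta x0 beta1 w s.
Proof.
move=> beta1_ge0; rewrite /beta /state.
by elim/last_ind: (take s w.1) => //= es e _; rewrite foldl_rcons epoch_step_beta_ge0.
Qed.

Definition epoch_prob (st : 'rV[R]_d * R) (e : epoch_sample n m B) : R :=
  outer_prob R (N st.2) e.1 * \prod_(t < m) (n%:R ^+ B)^-1.

Lemma epoch_prob_sum1 st : 0 <= st.2 -> \sum_e epoch_prob st e = 1.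
Proof.
move=> b_ge0.
have [/andP[_ Nn] _] := aba_batch_variance sigma_gt0 eps_gt0 n_gt0
  cbeta_ge16 ceps_ge16 rndP b_ge0.
rewrite -(pair_bigA _ (fun A (bs : m.-tuple (B.-tuple 'I_n)) =>
   outer_prob R (N st.2) A * \prod_(t < m) (n%:R ^+ B)^-1)) /=.
under eq_bigr => A _.
  rewrite -mulr_sumr.
  have -> : \sum_(bs : m.-tuple (B.-tuple 'I_n)) \prod_(t < m) (n%:R ^+ B)^-1
            = 1 :> R.
    have := @path_prob_sum1 R unit (B.-tuple 'I_n) (fun u _ => u)
      (fun _ _ => (n%:R ^+ B)^-1) (fun _ => True) (fun _ _ _ => I)
      (fun _ _ => minibatch_mass R B n_gt0) m tt I.
    by [].
  rewrite mulr1; over.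
exact: outer_prob_sum1.
Qed.

(** The potential (2 / eta) (f - inf f) + (m / 8) beta is nonnegative, and its
    mean drops in every epoch by the sum of the squared gradients, up to
    m eps / 8.  The coefficient m / 8 of beta is both what the inner loop
    leaves behind and what the variance (beta + eps) / 8 costs over m steps. *)
Lemma aba_expect_bound x0 beta1 : 0 <= beta1 ->
  run_expect fs eta N x0 beta1
    (fun w : run n m B S => enorm (grad f (output fs eta x0 beta1 w)) ^+ 2)
  <= (8 * L * (f x0 - inf (range f)) + m%:R / 8 * beta1
      + S%:R * (m%:R * eps / 8)) / (S%:R * m%:R).
Proof.
move=> b_ge0.
have eta0 := eta_gt0 L_gt0 eta_def.
pose h (st : 'rV[R]_d * R) (e : epoch_sample n m B) : R :=
  \sum_(t < m) enorm (grad f (inner_iter fs eta st.1 e t)) ^+ 2.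
pose Phi (st : 'rV[R]_d * R) : R :=
  2 / eta * (f st.1 - inf (range f)) + m%:R / 8 * st.2.
pose good (st : 'rV[R]_d * R) : Prop := 0 <= st.2.
have p_ge0 st e : good st -> 0 <= epoch_prob st e.
  move=> _; apply: mulr_ge0; first exact: outer_prob_ge0.
  by apply: prodr_ge0 => t _; rewrite invr_ge0 exprn_ge0.
have drop st : good st ->
    \sum_e epoch_prob st e * (h st e + Phi (epoch_step fs eta st e))
    <= Phi st + m%:R * eps / 8.
  move=> gst.
  have [N_bnd var] := aba_batch_variance sigma_gt0 eps_gt0 n_gt0
    cbeta_ge16 ceps_ge16 rndP gst.
  have := epoch_bound n_gt0 B_gt0 m_gt0 mB L_gt0 eta_def fs_diff fs_lip fs_var st N_bnd var.
  rewrite /Phi => EB.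
  under eq_bigr => e _.
    rewrite (_ : _ + _ = (h st e + (2 / eta * f (epoch_step fs eta st e).1
         + m%:R / 8 * (epoch_step fs eta st e).2))
         + (- (2 / eta * inf (range f)))); last by ring.
    rewrite mulrDr; over.
  rewrite big_split /= -mulr_suml epoch_prob_sum1 // mul1r.
  apply: le_trans (lerD EB (lexx _)) _.
  rewrite le_eqVlt; apply/orP; left; apply/eqP; ring.
have Phi_ge0 st : good st -> 0 <= Phi st.
  move=> gst; rewrite addr_ge0 ?mulr_ge0 ?invr_ge0 ?(ltW eta0) //.
  by rewrite subr_ge0; apply: ge_inf => //; exists st.1.
(* Telescoping over the epochs. *)
have bound := potential_bound (fun st e _ => epoch_step_beta_ge0 st e) p_ge0
  epoch_prob_sum1 drop S (b_ge0 : good (x0, beta1)).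
have eta_inv : 2 / eta = 8 * L by rewrite eta_def; field; rewrite gt_eqF.
rewrite {2}/Phi /= eta_inv -addrA in bound.
rewrite ler_pdivlMr ?mulr_gt0 ?ltr0n //.
rewrite -addrA.
apply: le_trans bound.
rewrite /run_expect mulr_suml.
rewrite -(pair_bigA _ (fun (es : S.-tuple (epoch_sample n m B)) (st : 'I_S * 'I_m) =>
  run_prob fs eta N x0 beta1 (es, st) *
  enorm (grad f (output fs eta x0 beta1 (es, st))) ^+ 2 * (S%:R * m%:R))) /=.
apply: ler_sum => es _.
have P_ge0 : 0 <= path_prob (epoch_step fs eta) epoch_prob (x0, beta1) es.
  rewrite /path_prob prodr_ge0 // => s _; apply: p_ge0.
  exact: (beta_ge0 x0 (es, (s, Ordinal m_gt0)) s b_ge0).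
have good_end : good (traj (epoch_step fs eta) (x0, beta1) es S).
  exact: (beta_ge0 x0 (es, (Ordinal S_gt0, Ordinal m_gt0)) S b_ge0).
have cancel (P Y : R) : P * (S%:R * m%:R)^-1 * Y * (S%:R * m%:R) = P * Y.
  by field; rewrite !pnatr_eq0 -!lt0n m_gt0.
apply: (@le_trans _ _ (path_prob (epoch_step fs eta) epoch_prob (x0, beta1) es *
  \sum_(s < S) h (traj (epoch_step fs eta) (x0, beta1) es s) (tnth es s))).
  rewrite /h pair_bigA mulr_sumr le_eqVlt; apply/orP; left; apply/eqP.
  apply: eq_bigr => [[s t]] _ /=.
  exact: cancel.
by rewrite ler_wpM2l // lerDl Phi_ge0.
Qed.
End Run.

(** * Oracle complexity *)

Section Complexity.
Context (R : realType).
Implicit Types (A eps kappa q y : R).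

Lemma epoch_count A eps (m : nat) : 0 < eps -> (0 < m)%N -> 0 <= A ->
  exists S : nat, [/\ (0 < S)%N, A <= S%:R * (m%:R * eps) &
    S%:R * (m%:R * eps) <= A + m%:R * eps].
Proof.
move=> eps_gt0 m_gt0 A_ge0.
have me_gt0 : 0 < m%:R * eps by rewrite mulr_gt0 ?ltr0n.
have r_ge0 : 0 <= A / (m%:R * eps) by rewrite divr_ge0 // ltW.
exists (Num.truncn (A / (m%:R * eps))).+1; split=> //.
  by rewrite -ler_pdivrMr // ltW // truncnS_gt.
rewrite -(natr1 (Num.truncn _)) mulrDl mul1r lerD2r -ler_pdivlMr //.
by rewrite truncn_le.
Qed.

(** With m of order sqrt B, the number S of epochs is at most
    (2 A + kappa) / (sqrt B eps): one epoch is needed even when A is small, and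
    this is where eps sqrt B <= kappa enters. *)
Lemma svrg_sfo_le (ceps sigma : R) A eps kappa (n m B S : nat) :
  let sB := Num.sqrt (B%:R : R) in
  (0 < B)%N -> 0 < eps -> 0 <= A -> 0 <= ceps ->
  sB / 2 <= m%:R -> m%:R < sB + 1 ->
  S%:R * (m%:R * eps) <= A + m%:R * eps -> eps * sB <= kappa ->
  svrg_sfo ceps sigma eps n m B S <=
  (2 * A + kappa) * (ceps * sigma ^+ 2 + 3) *
    (Num.min n%:R eps^-1 / (sB * eps) + B%:R / eps).
Proof.
move=> sB B_gt0 eps_gt0 A_ge0 ceps_ge0 m_lo m_hi Sm epsB.
have sB_ge1 : 1 <= sB by rewrite -sqrtr1 ler_wsqrtr // ler1n.
have sB_gt0 : 0 < sB by exact: lt_le_trans sB_ge1.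
have sB2 : sB ^+ 2 = B%:R by rewrite sqr_sqrtr.
have sBe_gt0 : 0 < sB * eps by rewrite mulr_gt0.
have m_gt0 : 0 < m%:R :> R by apply: lt_le_trans m_lo; lra.
set q := Num.min n%:R eps^-1.
have q_ge0 : 0 <= q by rewrite le_min ler0n invr_ge0 ltW.
set M := ceps * sigma ^+ 2 + 3.
have cs_ge0 : 0 <= ceps * sigma ^+ 2 by rewrite mulr_ge0 ?sqr_ge0.
have M_ge3 : 3 <= M by rewrite /M; lra.
set E := 2 * A + kappa.
(* For S >= 1 the slack sqrt B / 2 <= m applies to S - 1 epochs; the last
   epoch costs sqrt B eps <= kappa. *)
have S_le : S%:R * (sB * eps) <= E.
  have S1 : (S%:R - 1) * eps * m%:R <= A by lra.
  case: (leP 1 (S%:R : R)) => S_1.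
    have : (S%:R - 1) * eps * (sB / 2) <= (S%:R - 1) * eps * m%:R.
      by rewrite ler_wpM2l // mulr_ge0 ?subr_ge0 // ltW.
    by rewrite /E; lra.
  have : S%:R * (sB * eps) <= 1 * (sB * eps) by rewrite ler_wpM2r // ltW.
  by rewrite /E; lra.
have E_ge0 : 0 <= E by apply: le_trans S_le; rewrite mulr_ge0 // ltW.
have size_le : svrg_size ceps sigma eps n <= M * q.
  rewrite /svrg_size /q; case: (leP (n%:R : R) eps^-1) => ne.
    apply: (@le_trans _ _ n%:R); first by rewrite ge_min lexx orbT.
    have : 0 <= (M - 1) * n%:R by rewrite mulr_ge0 // subr_ge0; lra.
    lra.
  apply: (@le_trans _ _ (ceps * sigma ^+ 2 * eps^-1)).
    by rewrite ge_min lexx.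
  by rewrite ler_wpM2r ?invr_ge0 ?(ltW eps_gt0) // /M; lra.
rewrite /svrg_sfo mulrDr !natrM; apply: lerD.
  apply: (@le_trans _ _ (S%:R * (M * q))); first by rewrite ler_wpM2l.
  rewrite (_ : E * M * (q / (sB * eps)) = E / (sB * eps) * (M * q)); last first.
    by field; rewrite !gt_eqF.
  apply: ler_wpM2r; first by rewrite mulr_ge0 //; lra.
  by rewrite ler_pdivlMr.
have m2 : m%:R <= 2 * sB by lra.
apply: (@le_trans _ _ (E * 2 * (B%:R / eps))).
  rewrite (_ : E * 2 * (B%:R / eps) = E / (sB * eps) * (2 * sB * B%:R)); last first.
    by field; rewrite !gt_eqF.
  rewrite -mulrA; apply: ler_pM => //.
    by rewrite ler_pdivlMr.
  by rewrite ler_wpM2r.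
rewrite ler_wpM2r ?divr_ge0 ?(ltW eps_gt0) // ler_wpM2l //; lra.
Qed.

Lemma powR_min23 eps (n : nat) : 0 < eps ->
  Num.min (n%:R `^ (2 / 3)) (eps `^ (- (2 / 3))) =
  Num.min n%:R eps^-1 `^ (2 / 3) :> R.
Proof.
move=> eps_gt0.
have -> : eps `^ (- (2 / 3)) = eps^-1 `^ (2 / 3).
  by rewrite -(powR_inv1 (ltW eps_gt0)) -powRrM mulN1r.
have r_ge0 : (0 : R) <= 2 / 3 by [].
have n_nn : (n%:R : R) \in Num.nneg by rewrite nnegrE.
have e_nn : eps^-1 \in Num.nneg by rewrite nnegrE invr_ge0 ltW.
case: (leP (n%:R : R) eps^-1) => [le|/ltW le]; [apply/min_idPl | apply/min_idPr].
  exact: ge0_ler_powR.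
exact: ge0_ler_powR.
Qed.

Lemma powR23_cube q : 0 <= q -> (q `^ (2 / 3)) ^+ 3 = q ^+ 2.
Proof.
move=> q_ge0; rewrite -powR_mulrn ?powR_ge0 // -powRrM divfK //.
exact: powR_mulrn.
Qed.

(** The batch y = q^(2/3) balances q / sqrt B against B.  The condition
    y^3 = q^2 replaces real powers by polynomial inequalities; the lower bound
    on q keeps y away from 0, so that rounding B up to 1 costs a constant. *)
Lemma optimal_batch eps kappa q y (B : nat) :
  0 < eps -> eps <= kappa -> 0 < q -> 0 <= y -> y ^+ 3 = q ^+ 2 ->
  eps * q <= 1 -> (1 <= q \/ 1 <= kappa * q) -> (0 < B)%N ->
  y / 2 <= B%:R -> B%:R < y + 1 ->
  eps * Num.sqrt B%:R <= (kappa + 1) * (kappa + 2) /\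
  q / (Num.sqrt B%:R * eps) + B%:R / eps <= (kappa + 4) * (eps^-1 * y).
Proof.
move=> eps_gt0 eps_k q_gt0 y_ge0 yq eq1 q_lo B_gt0 B_lo B_hi.
have k_gt0 : 0 < kappa by exact: lt_le_trans eps_k.
set sB := Num.sqrt (B%:R : R).
have sB_ge1 : 1 <= sB by rewrite -sqrtr1 ler_wsqrtr // ler1n.
have sB_gt0 : 0 < sB by exact: lt_le_trans sB_ge1.
have sB2 : sB ^+ 2 = B%:R by rewrite sqr_sqrtr.
have sB_le : sB <= B%:R by rewrite -sB2 expr2 ler_peMl // ltW.
have kq : 1 <= (kappa + 1) * q.
  have kq0 : 0 < kappa * q by rewrite mulr_gt0.
  by case: q_lo => ?; lra.
have y_hi : y <= 1 + q.
  rewrite -(@ler_pXn2r _ 3) ?nnegrE //; last by lra.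
  rewrite yq.
  have -> : (1 + q) ^+ 3 = q ^+ 2 + (1 + 3 * q + 2 * q ^+ 2 + q ^+ 3) by ring.
  rewrite lerDl !addr_ge0 // ?mulr_ge0 ?exprn_ge0 // ltW //.
have y_lo : 1 <= (kappa + 1) * y.
  rewrite -(@ler_pXn2r _ 3) ?nnegrE //; last by rewrite mulr_ge0 //; lra.
  rewrite expr1n exprMn yq exprS -mulrA -exprMn.
  have k1 : 1 <= kappa + 1 by lra.
  by apply: le_trans k1 _; rewrite ler_peMr ?exprn_ege1 //; lra.
have B_le : B%:R <= (kappa + 2) * y by lra.
split.
  apply: (@le_trans _ _ (eps * ((kappa + 2) * (1 + q)))).
    rewrite ler_pM2l //; apply: le_trans sB_le _; apply: le_trans B_le _.
    by rewrite ler_wpM2l //; lra.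
  rewrite (_ : eps * ((kappa + 2) * (1 + q)) = (eps + eps * q) * (kappa + 2)).
    by rewrite ler_wpM2r; lra.
  by ring.
rewrite (_ : (kappa + 4) * (eps^-1 * y) =
             2 * y / eps + (kappa + 2) * y / eps); last by ring.
apply: lerD; last by rewrite ler_wpM2r // invr_ge0 ltW.
rewrite invfM mulrA ler_wpM2r ?invr_ge0 ?(ltW eps_gt0) // ler_pdivrMr //.
rewrite -ler_sqr ?nnegrE ?(ltW q_gt0) ?mulr_ge0 ?(ltW sB_gt0) //.
rewrite exprMn sB2 -yq.
have : y ^+ 2 * (y / 2) <= y ^+ 2 * B%:R by rewrite ler_wpM2l ?sqr_ge0.
have : 0 <= y ^+ 3 by rewrite exprn_ge0.
lra.
Qed.
End Complexity.

Section Comparison.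
Context (R : realType) (d n m B S : nat) (fs : 'I_n -> 'rV[R]_d -> R)
  (eta cbeta ceps sigma eps beta1 : R) (x0 : 'rV[R]_d) (beta1_gt0 : 0 < beta1).
Implicit Types (w : run n m B S).

Lemma aba_sfo_le w :
  aba_sfo fs eta cbeta ceps sigma eps x0 beta1 w <= svrg_sfo ceps sigma eps n m B S.
Proof.
rewrite /aba_sfo /svrg_sfo lerD2r -[S in S%:R]card_ord mulr_natl -sumr_const.
by apply: ler_sum => s _; exact: aba_size_le_svrg.
Qed.

(** A sum of terms, each at most a common bound, is strictly below the
    corresponding multiple exactly when one term is strictly smaller. *)
Lemma aba_sfo_lt w :
  aba_sfo fs eta cbeta ceps sigma eps x0 beta1 w < svrg_sfo ceps sigma eps n m B S
  <-> exists s : 'I_S,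
        0 < beta fs eta x0 beta1 w s /\
        cbeta * sigma ^+ 2 / beta fs eta x0 beta1 w s
          < svrg_size ceps sigma eps n.
Proof.
rewrite /aba_sfo /svrg_sfo ltrD2r -[S in S%:R]card_ord mulr_natl -sumr_const.
have b_ge0 (s : 'I_S) : 0 <= beta fs eta x0 beta1 w s.
  exact: beta_ge0 (ltW beta1_gt0).
split=> [|[s [b_gt0 lt_s]]].
  case: (pselect (exists s : 'I_S, 0 < beta fs eta x0 beta1 w s /\
    cbeta * sigma ^+ 2 / beta fs eta x0 beta1 w s
      < svrg_size ceps sigma eps n)) => // none.
  rewrite ltNge => /negP[]; apply: ler_sum => s _.
  rewrite leNgt aba_size_lt_svrg //; apply/negP => /andP[h1 h2].
  by apply: none; exists s.
rewrite (bigD1 s) //= [X in _ < X](bigD1 s) //=; apply: ltr_leD.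
  by rewrite aba_size_lt_svrg // b_gt0.
by apply: ler_sum => i _; exact: aba_size_le_svrg.
Qed.
End Comparison.

(** * Rate and complexity *)

Theorem corollary1 (R : realType) (L sigma cbeta ceps Delta kappa : R)
  (L_gt0 : 0 < L) (sigma_gt0 : 0 < sigma)
  (cbeta_ge16 : 16 <= cbeta) (ceps_ge16 : 16 <= ceps) (kappa_gt0 : 0 < kappa) :
  exists C : R, 0 < C /\
  forall (d n m B : nat) (fs : 'I_n -> 'rV[R]_d -> R) (x0 : 'rV[R]_d)
    (eps eta : R) (rnd : R -> nat),
  let f := mean_fun fs in
  (0 < n)%N -> (0 < B)%N -> 0 < eps ->
  (forall (i : 'I_n) (x : 'rV[R]_d),
     differentiable (fs i : 'rV[R]_d -> R^o) x) ->
  (forall (i : 'I_n) (x y : 'rV[R]_d),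
     enorm (grad (fs i) x - grad (fs i) y) <= L * enorm (x - y)) ->
  has_lbound (range f) ->
  f x0 - inf (range f) <= Delta ->
  (forall x : 'rV[R]_d,
     n%:R^-1 * \sum_(i < n) enorm (grad (fs i) x - grad f x) ^+ 2
       <= sigma ^+ 2) ->
  is_rounding rnd ->
  eta = 1 / (4 * L) ->
  m = rnd (Num.sqrt B%:R) ->
  let N := fun b : R => rnd (aba_size cbeta ceps sigma eps n b) in
  (forall (S : nat) (beta1 : R), 0 < beta1 -> beta1 <= eps * S%:R ->
   forall w : run n m B S,
     aba_sfo fs eta cbeta ceps sigma eps x0 beta1 w
       <= svrg_sfo ceps sigma eps n m B S
     /\
     (aba_sfo fs eta cbeta ceps sigma eps x0 beta1 w
        < svrg_sfo ceps sigma eps n m B S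
      <-> exists s : 'I_S,
            0 < beta fs eta x0 beta1 w s /\
            cbeta * sigma ^+ 2 / beta fs eta x0 beta1 w s
              < Num.min (ceps * sigma ^+ 2 * eps^-1) n%:R))
  /\
  exists S : nat,
  [/\ (0 < S)%N,
      forall beta1 : R, 0 < beta1 -> beta1 <= eps * S%:R ->
        run_expect fs eta N x0 beta1
          (fun w : run n m B S =>
             enorm (grad f (output fs eta x0 beta1 w)) ^+ 2) <= eps,
      eps * Num.sqrt B%:R <= kappa ->
        svrg_sfo ceps sigma eps n m B S
          <= C * (Num.min n%:R eps^-1 / (Num.sqrt B%:R * eps) + B%:R / eps)
    & B = rnd (Num.min (n%:R `^ (2 / 3)) (eps `^ (- (2 / 3)))) ->
      eps <= kappa ->
      (svrg_sfo ceps sigma eps n m B S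
         <= C * (eps^-1 * Num.min n%:R eps^-1 `^ (2 / 3)))
      /\
      (forall beta1 : R, 0 < beta1 -> beta1 <= eps * S%:R ->
       forall w : run n m B S,
         aba_sfo fs eta cbeta ceps sigma eps x0 beta1 w
           <= C * (eps^-1 * Num.min n%:R eps^-1 `^ (2 / 3)))].
Proof.
(* 11 instead of 32 / 3: then 8 L Delta <= (3 / 4) A.  The absolute value makes
   the constant positive for every Delta. *)
set A := 11 * L * `|Delta|.
have A_ge0 : 0 <= A by rewrite !mulr_ge0 // ltW.
(* Bound on eps sqrt B when B is the optimal batch. *)
set kappa' := (kappa + 1) * (kappa + 2).
have kk : kappa <= kappa'.
  by rewrite /kappa'; have := mulr_gt0 kappa_gt0 kappa_gt0; lra.
have ceps_ge0 : 0 <= ceps by exact: le_trans ceps_ge16.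
set C1 := (2 * A + kappa') * (ceps * sigma ^+ 2 + 3).
have C1_gt0 : 0 < C1.
  apply: mulr_gt0; first by lra.
  by apply: ltr_wpDl => //; rewrite mulr_ge0 ?sqr_ge0.
have C_gt0 : 0 < C1 * (kappa + 4) by apply: mulr_gt0 => //; lra.
have C1_le : C1 <= C1 * (kappa + 4) by rewrite ler_pMr //; lra.
exists (C1 * (kappa + 4)); split=> //.
move=> d n m B fs x0 eps eta rnd f n_gt0 B_gt0 eps_gt0 fs_diff fs_lip f_lb
  f_gap fs_var rndP eta_def m_def N; split.
  move=> S beta1 beta1_gt0 _ w; split; first exact: aba_sfo_le.
  exact: aba_sfo_lt.
have sB_gt0 : 0 < Num.sqrt B%:R :> R by rewrite sqrtr_gt0 ltr0n.
have m_gt0 : (0 < m)%N by rewrite m_def; case: (rndP _ sB_gt0).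
have [m_lo m_hi] := rnd_bounds rndP sB_gt0; rewrite -m_def in m_lo m_hi.
have mB : (m ^ 2 <= 2 * B)%N by rewrite m_def; exact: rnd_sqrt_sqr.
have [S [S_gt0 S_lo S_hi]] := epoch_count eps_gt0 m_gt0 A_ge0.
have q_ge0 : 0 <= Num.min n%:R eps^-1 by rewrite le_min ler0n invr_ge0 ltW.
have q_gt0 : 0 < Num.min n%:R eps^-1 by rewrite lt_min ltr0n n_gt0 invr_gt0.
have complexity : eps * Num.sqrt B%:R <= kappa' ->
    svrg_sfo ceps sigma eps n m B S <=
    C1 * (Num.min n%:R eps^-1 / (Num.sqrt B%:R * eps) + B%:R / eps).
  exact: svrg_sfo_le.
have best : B = rnd (Num.min (n%:R `^ (2 / 3)) (eps `^ (- (2 / 3)))) ->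
    eps <= kappa ->
    svrg_sfo ceps sigma eps n m B S <=
    C1 * (kappa + 4) * (eps^-1 * Num.min n%:R eps^-1 `^ (2 / 3)).
  rewrite powR_min23 // => B_def eps_k.
  have y_gt0 : 0 < Num.min n%:R eps^-1 `^ (2 / 3) by rewrite powR_gt0.
  have [B_lo B_hi] := rnd_bounds rndP y_gt0; rewrite -B_def in B_lo B_hi.
  have [||sB_k rate] := optimal_batch eps_gt0 eps_k q_gt0 (ltW y_gt0)
    (powR23_cube q_ge0) _ _ B_gt0 B_lo B_hi.
  - by rewrite -ler_pdivlMl // mulr1 ge_min lexx orbT.
  - case: (leP (n%:R : R) eps^-1) => _; [left; by rewrite ler1n | right].
    by rewrite ler_pdivlMr // mul1r.
  apply: le_trans (complexity sB_k) _.
  by rewrite -[X in _ <= X]mulrA ler_pM2l.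
exists S; split=> //.
- move=> beta1 beta1_gt0 beta1_le.
  apply: le_trans (aba_expect_bound n_gt0 B_gt0 m_gt0 S_gt0 mB L_gt0 eta_def
    sigma_gt0 eps_gt0 cbeta_ge16 ceps_ge16 rndP fs_diff fs_lip f_lb fs_var
    x0 (ltW beta1_gt0)) _.
  rewrite ler_pdivrMr ?mulr_gt0 ?ltr0n //.
  have gap : 8 * L * (f x0 - inf (range f)) <= 3 / 4 * A.
    have : L * (f x0 - inf (range f)) <= L * `|Delta|.
      by rewrite ler_pM2l //; apply: le_trans f_gap _; exact: ler_norm.
    have : 0 <= L * `|Delta| by rewrite mulr_ge0 // ltW.
    rewrite /A; lra.
  have : m%:R / 8 * beta1 <= m%:R / 8 * (eps * S%:R) by rewrite ler_wpM2l.
  by rewrite -/f; lra.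
- move=> epsB; apply: le_trans (complexity (le_trans epsB kk)) _.
  rewrite ler_wpM2r // addr_ge0 // divr_ge0 ?mulr_ge0 ?sqrtr_ge0 // ltW //.
move=> B_def eps_k; split=> [|beta1 _ _ w]; first exact: best.
by apply: le_trans (best B_def eps_k); exact: aba_sfo_le.
Qed.
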